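(* Let $f_1,\dots,f_N:\mathbb{R}^N\to\mathbb{R}$ be the players' cost functions. Suppose that each $f_i$ is a $\mathcal{C}^2$ function and that there exists a constant $m>0$ such that $(\mathbf{x}-\mathbf{z})^T(\bar{\mathcal{P}}(\mathbf{x})-\bar{\mathcal{P}}(\mathbf{z}))\ge m\|\mathbf{x}-\mathbf{z}\|^2$ for all $\mathbf{x},\mathbf{z}\in\mathbb{R}^N$, where $\bar{\mathcal{P}}(\mathbf{x})=[\nabla_1f_1(\mathbf{x}),\dots,\nabla_Nf_N(\mathbf{x})]^T$. For control gains $\alpha,\beta>0$ consider the system $$\dot{\mathbf{x}}=\nu,\qquad \dot\nu=-\alpha\,\bar{\mathcal{P}}(\mathbf{x})-\beta\nu-H(\mathbf{x})\nu,\qquad \mathbf{x},\nu\in\mathbb{R}^N,$$ where $H(\mathbf{x})=\left[\frac{\partial^2f_i(\mathbf{x})}{\partial x_i\partial x_j}\right]$ is the $N\times N$ matrix with the indicated $(i,j)$ entry. Then there exists a positive constant $\alpha^*$ such that for each $\alpha\in(0,\alpha^* )$ there exists a positive constant $\beta^*(\alpha)$ such that for each $\beta\in(0,\beta^*(\alpha))$ the Nash equilibrium is globally asymptotically stable under this system, i.e. the equilibrium $(\mathbf{x},\nu)=(\mathbf{x}^*,\mathbf{0})$ is globally asymptotically stable.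
   Context: There is a game with $N$ players; player $i$ has action $x_i\in\mathbb{R}$ and cost function $f_i(\mathbf{x})$, $\mathbf{x}=[x_1,\dots,x_N]^T$. Also write $f_i(\mathbf{x})=f_i(x_i,\mathbf{x}_{-i})$ with $\mathbf{x}_{-i}=[x_1,\dots,x_{i-1},x_{i+1},\dots,x_N]^T$. Notation: $\nabla_if_i(\mathbf{x})=\frac{\partial f_i(\mathbf{x})}{\partial x_i}$; $\nu=[\nu_1,\dots,\nu_N]^T$ is the vector of players' velocities. A Nash equilibrium is a point $\mathbf{x}^*=(x_i^*,\mathbf{x}_{-i}^* )\in\mathbb{R}^N$ such that $f_i(x_i^*,\mathbf{x}_{-i}^* )\le f_i(x_i,\mathbf{x}_{-i}^* )$ for all $x_i\in\mathbb{R}$ and all $i\in\{1,\dots,N\}$. (Under the stated monotonicity hypothesis it exists and is unique, and it is the unique zero of $\bar{\mathcal P}$.) *)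

(* Defs.v *)
From HB Require Import structures.
From mathcomp Require Import all_boot all_order all_algebra.
From mathcomp Require Import all_classical all_reals all_analysis.

Set Implicit Arguments.
Unset Strict Implicit.
Unset Printing Implicit Defensive.

Import Order.TTheory GRing.Theory Num.Theory.
Import numFieldNormedType.Exports.

Local Open Scope classical_set_scope.
Local Open Scope ring_scope.

Section Calculus.
Context {R : realType} {N : nat}.
Implicit Types (g : 'cV[R]_N -> R) (i : 'I_N) (k : nat).

Definition unit_vec i : 'cV[R]_N := delta_mx i 0.

Definition partial i g : 'cV[R]_N -> R := fun x => 'D_(unit_vec i) g x.

(* All partial derivatives of order at most k exist everywhere and are
   continuous.  The existence clause is needed because 'D_v is total. *)
Fixpoint Ck k g : Prop :=
  continuous g /\
  if k is k'.+1 then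
    forall i, (forall x, derivable g x (unit_vec i)) /\ Ck k' (partial i g)
  else True.

(* The library norm `|x| on matrices is the sup norm. *)
Definition euclid_norm (x : 'cV[R]_N) : R := Num.sqrt (\sum_i x i 0 ^+ 2).

End Calculus.

Section Game.
Context {R : realType} {N : nat}.
Variable f : 'I_N -> 'cV[R]_N -> R.

(* The profile (y, x_{-i}). *)
Definition deviate (x : 'cV[R]_N) (i : 'I_N) (y : R) : 'cV[R]_N :=
  \col_j (if j == i then y else x j 0).

Definition is_nash (x : 'cV[R]_N) : Prop :=
  forall (i : 'I_N) (y : R), f i x <= f i (deviate x i y).

Definition pseudo_gradient (x : 'cV[R]_N) : 'cV[R]_N :=
  \col_i partial i (f i) x.

(* The (i, j) entry is d/dx_i (d f_i / dx_j). *)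
Definition game_hessian (x : 'cV[R]_N) : 'M[R]_N :=
  \matrix_(i, j) partial i (partial j (f i)) x.

(* The state is the pair (x, nu). *)
Definition closed_loop (alpha beta : R) (s : 'cV[R]_N * 'cV[R]_N) :
    'cV[R]_N * 'cV[R]_N :=
  (s.2,
   - (alpha *: pseudo_gradient s.1) - beta *: s.2 - game_hessian s.1 *m s.2).

End Game.

Section Stability.
Context {R : realType} {V : normedModType R}.
Variable F : V -> V.

(* z solves z' = F(z) on [0, T[, with T possibly +oo.  Since z is only
   relevant for nonnegative times, the equation is required on ]0, T[ together
   with continuity on [0, T[; for continuous F this makes it hold at 0 for the
   right derivative. *)
Definition is_solution (T : \bar R) (z : R -> V) : Prop :=
  {within [set t : R | 0 <= t /\ (t%:E < T)%E], continuous z} /\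
  (forall t : R, 0 < t -> (t%:E < T)%E -> is_derive t 1 z (F (z t))).

Definition lyapunov_stable (e : V) : Prop :=
  forall eps : R, 0 < eps -> exists2 delta : R, 0 < delta &
    forall (T : \bar R) (z : R -> V), is_solution T z -> `|z 0 - e| < delta ->
      forall t : R, 0 <= t -> (t%:E < T)%E -> `|z t - e| < eps.

(* Every initial state launches a solution on [0, +oo[, and no solution
   escapes in finite time. *)
Definition forward_complete : Prop :=
  (forall z0 : V, exists2 z : R -> V, is_solution +oo%E z & z 0 = z0) /\
  (forall (T : \bar R) (z : R -> V), is_solution T z ->
    exists2 z' : R -> V, is_solution +oo%E z' &
      forall t : R, 0 <= t -> (t%:E < T)%E -> z' t = z t).

Definition globally_attractive (e : V) : Prop :=
  forall z : R -> V, is_solution +oo%E z -> z t @[t --> +oo] --> e.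

(* On a finite-dimensional V this does not depend on the norm.  Forward
   completeness is included so that attractivity, which only speaks of
   solutions on [0, +oo[, covers every trajectory. *)
Definition globally_asymptotically_stable (e : V) : Prop :=
  [/\ F e = 0, lyapunov_stable e, forward_complete & globally_attractive e].

End Stability.

(* Main.v *)
Require Import Defs.
From HB Require Import structures.
From mathcomp Require Import all_boot all_order all_algebra.
From mathcomp Require Import all_classical all_reals all_analysis.
From mathcomp Require Import ring lra.

Set Implicit Arguments.
Unset Strict Implicit.
Unset Printing Implicit Defensive.

Import Order.TTheory GRing.Theory Num.Theory.
Import numFieldNormedType.Exports.

Local Open Scope classical_set_scope.
Local Open Scope ring_scope.

(** Write P for the pseudo-gradient.  Its Jacobian has (i, j) entry d_j d_i f_i,
    which by the symmetry of second derivatives ([partialC]) is the entry of the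
    matrix H of the closed loop.  Hence H(x) nu is the derivative of P(x) along a
    trajectory, and nu + P(x) has derivative - alpha P(x) - beta nu, in which H
    no longer occurs.  With delta = alpha - beta and z = nu + P(x) - delta x the
    closed loop becomes

      x' = z - P(x) + delta x,      z' = - alpha z - alpha delta x.

    For the difference (x, z) of two solutions, the cross terms in the
    derivative of the energy |z|^2 + alpha delta |x|^2 cancel, and strong
    monotonicity bounds that derivative by

      - 2 alpha |z|^2 - 2 alpha delta (m - delta) |x|^2          ([dissipation]).

    If 0 < delta < m the distance between any two solutions therefore decays
    exponentially ([gap_decay]).  The thresholds are thus alpha* = m and
    beta*(alpha) = alpha.  This single contraction estimate gives uniqueness of
    solutions and, applied to a solution and the equilibrium, both Lyapunov
    stability and global attractivity.

    Forward completeness also needs the existence of global solutions.  The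
    closed loop itself is only continuous, because H is, but the field in the
    coordinates (x, z) is Lipschitz on bounded sets, P being of class C^1.
    Composed with the clamping onto a large cube it becomes bounded and globally
    Lipschitz, so that Picard iteration ([picard]) produces a global solution.
    Where the clamping has no effect the energy relative to the equilibrium does
    not increase, so a solution starting well inside the cube never leaves it
    ([derive_barrier]) and solves the original system ([global_solution]).

    The Nash equilibria are the zeros of P ([is_nashP]).  A zero exists because
    |P|^2 is coercive, hence attains its minimum, and at a point where
    p = P(x) <> 0 a small step from x in the direction - p decreases |P|^2
    ([strongly_monotone_zero]); it is unique by strong monotonicity. *)

(** * Curves and real functions of one variable *)

Section OneVariable.
Context {R : realType}.

Lemma is_derive1P (V : normedModType R) (f : R -> V) (t : R) (df : V) :
  is_derive t 1 f df <->
  (fun h : R => h^-1 *: (f (h + t) - f t)) @ 0^' --> df.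
Proof.
have -> : (fun h : R => h^-1 *: (f (h + t) - f t)) =
          (fun h : R => h^-1 *: ((f \o shift t) (h *: (1 : R^o)) - f t)).
  by apply/funext => h /=; rewrite [_ *: 1]mulr1.
split=> [[df1 <-]|cf]; first exact: df1.
by apply: DeriveDef; [apply/cvg_ex; exists df | apply/cvg_lim].
Qed.

Lemma is_derive1_continuous (V : normedModType R) (f : R -> V) (t : R) (df : V) :
  is_derive t 1 f df -> {for t, continuous f}.
Proof.
by case=> df1 _; apply/differentiable_continuous/derivable1_diffP.
Qed.

Lemma is_derive_pair (V W : normedModType R) (f : R -> V) (g : R -> W)
    (t : R) (df : V) (dg : W) :
  is_derive t 1 f df -> is_derive t 1 g dg ->
  is_derive t 1 (fun s => (f s, g s)) (df, dg).
Proof.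
move=> /is_derive1P cf /is_derive1P cg; apply/is_derive1P.
exact: cvg_pair.
Qed.

Lemma is_derive_fst (V W : normedModType R) (f : R -> V * W) (t : R) (df : V * W) :
  is_derive t 1 f df -> is_derive t 1 (fun s => (f s).1) df.1.
Proof.
move=> /is_derive1P cf; apply/is_derive1P.
exact: (cvg_comp _ _ cf (@cvg_fst _ _ (nbhs df.1) (nbhs df.2) _)).
Qed.

Lemma is_derive_snd (V W : normedModType R) (f : R -> V * W) (t : R) (df : V * W) :
  is_derive t 1 f df -> is_derive t 1 (fun s => (f s).2) df.2.
Proof.
move=> /is_derive1P cf; apply/is_derive1P.
exact: (cvg_comp _ _ cf (@cvg_snd _ _ (nbhs df.1) (nbhs df.2) _)).
Qed.

Lemma is_derive_mxP (m n : nat) (M : R -> 'M[R]_(m, n)) (t : R)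
    (dM : 'M[R]_(m, n)) :
  is_derive t 1 M dM <->
  forall i j, is_derive t 1 (fun s => M s i j) (dM i j).
Proof.
split=> [[Mt <-] i j|Mt].
  by apply: DeriveDef; [exact: (derivable_mxP M t 1).1 | rewrite derive_mx// mxE].
have Mt' : derivable M t 1 by apply/derivable_mxP => i j; case: (Mt i j).
apply: DeriveDef => //; rewrite derive_mx//; apply/matrixP => i j.
by rewrite mxE; case: (Mt i j).
Qed.

(** Both orders of the end points are allowed, so that increments along a
    coordinate axis may have either sign. *)
Lemma MVT_between (f df : R -> R) (a b : R) :
  (forall x : R, is_derive x 1 f (df x)) ->
  exists2 c, Num.min a b <= c <= Num.max a b & f b - f a = df c * (b - a).
Proof.
move=> fdf.
have cf A : {within A, continuous f}.
  apply: continuous_subspaceT => x.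
  exact: is_derive1_continuous (fdf x).
have [ab|/ltW ba] := leP a b.
  have [c + fE] := MVT_segment ab (fun x _ => fdf x) (cf _).
  by rewrite in_itv/= => cab; exists c.
have [c + fE] := MVT_segment ba (fun x _ => fdf x) (cf _).
rewrite in_itv/= => cab; exists c => //.
by rewrite -opprB fE -mulrN opprB.
Qed.

Lemma decreasing_of_derive_le0 (f df : R -> R) (a b : R) : a <= b ->
  {within `[a, b], continuous f} ->
  (forall t : R, a < t < b -> is_derive t 1 f (df t)) ->
  (forall t, a < t < b -> df t <= 0) -> f b <= f a.
Proof.
move=> ab cf fdf df0.
apply: (@ler0_derive1_le_cc _ f a b) => //.
- by move=> x; rewrite in_itv/= => xab; have [] := fdf x xab.
- move=> x; rewrite in_itv/= => xab; rewrite derive1E.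
  by have [_ ->] := fdf x xab; exact: df0.
- by rewrite in_itv/= lexx ab.
- by rewrite in_itv/= lexx ab.
Qed.

(** At the first time tau with b <= phi tau, phi is below b on [0, tau[, hence
    nonincreasing on [0, tau], which contradicts phi 0 < b <= phi tau. *)
Lemma derive_barrier (phi dphi : R -> R) (b : R) : continuous phi -> phi 0 < b ->
  (forall t : R, 0 < t -> is_derive t 1 phi (dphi t)) ->
  (forall t, 0 < t -> phi t < b -> dphi t <= 0) ->
  forall t, 0 <= t -> phi t < b.
Proof.
move=> cphi phi0 phid dphi_le0 t1 t10; rewrite ltNge; apply/negP => bt1.
pose S := [set t | 0 <= t /\ b <= phi t]; pose tau := inf S.
have S0 : S !=set0 by exists t1.
have lbS : has_lbound S by exists 0 => t [].
have infS : has_inf S by [].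
have tau0 : 0 <= tau by apply: lb_le_inf => // t [].
have tau_le t : S t -> tau <= t by exact: ge_inf.
have btau : b <= phi tau.
  rewrite leNgt; apply/negP => tb.
  have e0 : 0 < b - phi tau by rewrite subr_gt0.
  have /cvgrPdist_lt/(_ _ e0)/nbhs_normP[d /= d0 dP] := cphi tau.
  have [s Ss std] := inf_adherent d0 infS.
  have sd : `|tau - s| < d.
    by rewrite distrC ger0_norm ?subr_ge0 ?tau_le // ltrBlDl.
  have := dP s sd; rewrite distrC => /(le_lt_trans (ler_norm _)).
  by rewrite ltrD2r ltNge; case: Ss => _ ->.
suff : phi tau <= phi 0 by rewrite leNgt (lt_le_trans phi0).
apply: (@decreasing_of_derive_le0 phi dphi 0 tau) => //.
- exact: continuous_subspaceT.
- by move=> t /andP[t0 _]; exact: phid.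
- move=> t /andP[t0 ttau]; apply: dphi_le0 => //; rewrite ltNge; apply/negP => bt.
  by have := tau_le t (conj (ltW t0) bt); rewrite leNgt ttau.
Qed.

Lemma is_derive_expRM (K t : R) :
  is_derive t 1 (fun s : R => expR (K * s)) (K * expR (K * t)).
Proof.
have h : is_derive t 1 (fun s : R => K * s) K.
  have := is_deriveZ K (is_derive_id t (1 : R)).
  by rewrite [_ *: 1]mulr1.
by have := is_derive1_comp (is_derive_expR (K * t)) h; rewrite mulrC.
Qed.

End OneVariable.

(** * Column vectors with the sup norm *)

Section VectorNorm.
Context {R : realType} {n : nat}.
Implicit Types x y : 'cV[R]_n.

Lemma normcv_le x (c : R) : 0 <= c -> (`|x| <= c) <-> (forall i, `|x i 0| <= c).
Proof.
move=> c0; rewrite {1}/Num.Def.normr/= mx_normrE; split=> [xc i|xc].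
  by apply: le_trans xc; exact: (le_bigmax _ _ (i, ord0)).
by apply: bigmax_le => //= -[i j] _ /=; rewrite ord1.
Qed.

Lemma normcv_coord x i : `|x i 0| <= `|x|.
Proof. exact: (normcv_le x (normr_ge0 x)).1. Qed.

Lemma cvg_cvP (T : Type) (F : set_system T) {FF : Filter F} (f : T -> 'cV[R]_n)
    (l : 'cV[R]_n) :
  (f @ F --> l) <-> forall i, f x i 0 @[x --> F] --> l i 0.
Proof.
split=> [fl i|fl].
  exact: (cvg_comp _ _ fl (@coord_continuous _ _ _ i 0 l)).
apply/cvgrPdist_le => /= e e0; near=> x.
apply/(normcv_le _ (ltW e0)) => i; rewrite !mxE.
move: i; near: x; apply: filter_forall => i.
by have /cvgrPdist_le := fl i; exact.
Unshelve. all: by end_near. Qed.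

(** A closed ball of the sup norm is a product of segments, compact by
    Tychonoff for row vectors; transposition carries this to columns. *)
Lemma compact_ballcv (r : R) : compact [set x : 'cV[R]_n | `|x| <= r].
Proof.
have [r0|r0] := leP 0 r; last first.
  rewrite (_ : mkset _ = set0); first exact: compact0.
  rewrite -subset0 => x /= xr.
  by have := lt_le_trans r0 (normr_ge0 x); rewrite ltNge xr.
pose A := [set v : 'rV[R]_n | forall i, `[- r, r]%classic (v ord0 i)].
have cA : compact A.
  by apply: (@rV_compact _ _ (fun=> `[- r, r]%classic)) => i; exact: segment_compact.
rewrite (_ : mkset _ = (fun v : 'rV[R]_n => v^T) @` A).
  apply: continuous_compact => //; apply: continuous_subspaceT => v.
  apply: (@cvg_cvP _ (nbhs v) _ _ _).2 => i; rewrite mxE.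
  under eq_fun do rewrite mxE.
  exact: coord_continuous.
apply/seteqP; split=> [x /= xr|_ /= [v Av <-]].
  exists x^T; last by rewrite trmxK.
  move=> i /=; rewrite in_itv/= mxE -ler_norml.
  exact: le_trans (normcv_coord _ _) xr.
apply/normcv_le => // i; rewrite mxE ler_norml.
by have := Av i; rewrite /= in_itv.
Qed.

Lemma continuous_bounded_ball (g : 'cV[R]_n -> R) (r : R) :
  continuous g -> exists2 M, 0 < M & forall x, `|x| <= r -> `|g x| <= M.
Proof.
move=> cg.
have : bounded_set (g @` [set x : 'cV[R]_n | `|x| <= r]).
  apply: compact_bounded; apply: continuous_compact; last exact: compact_ballcv.
  exact: continuous_subspaceT.
move=> /ex_strict_bound_gt0[M M0 gM]; exists M => // x xr; apply: ltW.
by apply: gM; exists x.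
Qed.

End VectorNorm.

Section BlocksAndClamping.
Context {R : realType}.

Lemma normcv_usubmx (k l : nat) (u : 'cV[R]_(k + l)) : `|usubmx u| <= `|u|.
Proof. by apply/normcv_le => // i; rewrite mxE normcv_coord. Qed.

Lemma normcv_dsubmx (k l : nat) (u : 'cV[R]_(k + l)) : `|dsubmx u| <= `|u|.
Proof. by apply/normcv_le => // i; rewrite mxE normcv_coord. Qed.

Lemma normcv_col_mx (k l : nat) (u : 'cV[R]_k) (v : 'cV[R]_l) (c : R) :
  `|u| <= c -> `|v| <= c -> `|col_mx u v| <= c.
Proof.
move=> uc vc; have c0 := le_trans (normr_ge0 _) uc.
apply/normcv_le => // i; rewrite mxE; case: fintype.split => j;
  by rewrite (le_trans (normcv_coord _ _)).
Qed.

(** A 1-Lipschitz retraction onto the sup-norm ball: a field that is Lipschitz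
    on that ball becomes bounded and globally Lipschitz when composed with it. *)
Definition clamp (k : nat) (r : R) (u : 'cV[R]_k) : 'cV[R]_k :=
  \col_i Num.max (- r) (Num.min r (u i 0)).

Lemma clamp_le (k : nat) (r : R) (u : 'cV[R]_k) : 0 <= r -> `|clamp r u| <= r.
Proof.
move=> r0; apply/normcv_le => // i; rewrite mxE ler_norml le_max lexx /=.
by rewrite ge_max ge_min lexx /= andbT; lra.
Qed.

Lemma clamp_id (k : nat) (r : R) (u : 'cV[R]_k) : `|u| <= r -> clamp r u = u.
Proof.
move=> ur; apply/colP => i; rewrite mxE.
have := le_trans (normcv_coord u i) ur; rewrite ler_norml => /andP[a b].
by rewrite min_r // max_r.
Qed.

Lemma clamp_lipschitz (k : nat) (r : R) (u v : 'cV[R]_k) :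
  `|clamp r u - clamp r v| <= `|u - v|.
Proof.
apply/normcv_le => // i; have := normcv_coord (u - v) i.
rewrite !mxE !ler_norml; move: (u i 0) (v i 0) `|u - v| => a b c /andP[h1 h2].
have min_lip : - c <= Num.min r a - Num.min r b <= c.
  by case: (leP r a) => ra; case: (leP r b) => rb; apply/andP; split; lra.
move: (Num.min r a) (Num.min r b) min_lip => a' b' /andP[h3 h4].
by case: (leP (- r) a') => ra; case: (leP (- r) b') => rb; apply/andP; split; lra.
Qed.

End BlocksAndClamping.

(** * Calculus in several variables *)

Section SeveralVariables.
Context {R : realType} {n : nat}.
Implicit Types (g : 'cV[R]_n -> R) (x y : 'cV[R]_n).

Lemma is_derive_line g (x v : 'cV[R]_n) (t : R) :
  (forall y, derivable g y v) ->
  is_derive t 1 (fun s : R => g (x + s *: v)) ('D_v g (x + t *: v)).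
Proof.
move=> gv; apply/is_derive1P.
have <- : (fun h : R => h^-1 *: ((g \o shift (x + t *: v)) (h *: v) - g (x + t *: v))) =
  (fun h : R => h^-1 *: (g (x + (h + t) *: v) - g (x + t *: v))).
  by apply/funext => h /=; rewrite scalerDl addrCA.
exact: gv.
Qed.

(** Move from x to y by changing one coordinate at a time and apply the mean
    value theorem to each step.  Every intermediate point has each coordinate
    equal to that of x or of y except one, which lies between the two; this
    gives the two norm bounds, the first for estimates on balls, the second for
    limits as y tends to x. *)
Lemma coordinate_mean_value g x y :
  (forall i z, derivable g z (unit_vec i)) ->
  exists xi : 'I_n -> 'cV[R]_n,
    [/\ forall i, `|xi i| <= Num.max `|x| `|y|,
        forall i, `|xi i - x| <= `|y - x| &
        g y - g x = \sum_i (y i 0 - x i 0) * partial i g (xi i)].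
Proof.
move=> dg.
pose p (k : nat) : 'cV[R]_n := \col_j (if (j < k)%N then y j 0 else x j 0).
have pS (k : 'I_n) : p k.+1 = p k + (y k 0 - x k 0) *: unit_vec k.
  apply/colP => j; rewrite !mxE eqxx andbT ltnS leq_eqVlt.
  have [->|jk] := eqVneq j k; first by rewrite eqxx ltnn mulr1 addrC subrK.
  by rewrite mulr0 addr0 (inj_eq val_inj) (negbTE jk).
have mv (k : 'I_n) : exists s : R, 
    Num.min 0 (y k 0 - x k 0) <= s <= Num.max 0 (y k 0 - x k 0) /\
    g (p k.+1) - g (p k) =
      (y k 0 - x k 0) * partial k g (p k + s *: unit_vec k).
  have [s sI E] := @MVT_between R (fun s => g (p k + s *: unit_vec k)) _
    0 (y k 0 - x k 0) (fun t => is_derive_line (p k) t (dg k)).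
  exists s; split=> //; move: E.
  by rewrite -pS scale0r addr0 subr0 => ->; rewrite mulrC.
have [s sP] := choice mv.
have xiE (k j : 'I_n) : (p k + s k *: unit_vec k) j 0 =
    if (j < k)%N then y j 0 else x j 0 + (if j == k then s k else 0).
  rewrite !mxE eqxx andbT; case: ltnP => [jk|kj].
    by rewrite (negbTE (_ : j != k)) ?mulr0 ?addr0 // -(inj_eq val_inj) neq_ltn jk.
  by case: eqP; rewrite ?mulr1 ?mulr0.
exists (fun k : 'I_n => p k + s k *: unit_vec k); split.
- move=> k; apply/normcv_le => [|j]; first by rewrite le_max normr_ge0.
  rewrite xiE; case: ifP => _; first by rewrite le_max normcv_coord orbT.
  have xM := normcv_coord x j; have yM := normcv_coord y j.
  rewrite le_max; case: eqP => [->|_]; last by rewrite addr0 xM.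
  have [+ _] := sP k; have {}xM := normcv_coord x k; have {}yM := normcv_coord y k.
  have [yx|yx] := leP 0 (y k 0 - x k 0) => /andP[s1 s2]; 
  move: xM yM; rewrite !ler_norml => /andP[a1 a2] /andP[b1 b2];
  have [xy|/ltW xy] := leP `|x| `|y|; apply/orP; (try by left; lra); by right; lra.
- move=> k; apply/normcv_le => // j.
  rewrite [(_ - x) j 0]mxE [(- x) j 0]mxE xiE.
  have := normcv_coord (y - x) j; rewrite !mxE => yxj.
  case: ifP => _ //; rewrite addrAC subrr add0r.
  case: eqP => [jk|_]; last by rewrite normr0.
  apply: le_trans yxj; rewrite jk.
  have [+ _] := sP k.
  have [yx|yx] := leP 0 (y k 0 - x k 0) => /andP[s1 s2].
    by rewrite !ger0_norm.
  by rewrite !ler0_norm ?lerN2 // ltW.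
have -> : g y - g x = \sum_(0 <= k < n) (g (p k.+1) - g (p k)).
  rewrite telescope_sumr //; congr (g _ - g _); apply/colP => j; rewrite mxE //.
  by rewrite ltn_ord.
rewrite big_mkord; apply: eq_bigr => k _.
by have [_ ->] := sP k.
Qed.

Lemma Ck1_lipschitz_ball g (r : R) : Ck 1 g ->
  exists2 L, 0 < L & forall x y, `|x| <= r -> `|y| <= r ->
    `|g y - g x| <= L * `|y - x|.
Proof.
move=> [_ dg].
have /choice[M MP] i : exists M, 0 < M /\ forall x, `|x| <= r -> `|partial i g x| <= M.
  have [_ [cp _]] := dg i.
  by have [M M0 gM] := continuous_bounded_ball r cp; exists M.
exists (1 + \sum_i M i).
  by rewrite ltr_wpDr // sumr_ge0 // => i _; exact/ltW/(MP i).1.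
move=> x y xr yr.
have [xi [xib _ ->]] := coordinate_mean_value x y (fun i => (dg i).1).
apply: (le_trans (ler_norm_sum _ _ _)).
rewrite mulrDl mul1r mulr_suml ler_wpDl //; apply: ler_sum => i _.
rewrite normrM mulrC ler_pM //; last first.
  by have := normcv_coord (y - x) i; rewrite !mxE.
by apply: (MP i).2; apply: (le_trans (xib i)); rewrite ge_max xr yr.
Qed.

(** Divided by h, the coordinate mean value formula between c(t) and c(t + h)
    converges term by term, since its intermediate points tend to c(t) and the
    partial derivatives are continuous. *)
Lemma Ck1_chain_rule g (c : R -> 'cV[R]_n) (t : R) (dc : 'cV[R]_n) :
  Ck 1 g -> is_derive t 1 c dc ->
  is_derive t 1 (g \o c) (\sum_i dc i 0 * partial i g (c t)).
Proof.
move=> [_ dg] cdc; apply/is_derive1P.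
have /choice[xi xiP] h := coordinate_mean_value (c t) (c (h + t)) (fun i => (dg i).1).
have cc : c (h + t) @[h --> 0^'] --> c t.
  apply: cvg_within_filter.
  have : {for t, continuous c} by exact: is_derive1_continuous cdc.
  rewrite /prop_for /continuous_at -{1}(add0r t) => cct.
  apply: (cvg_comp (fun h => h + t) c _ cct).
  by apply: cvgD; [exact: cvg_id | exact: cvg_cst].
have -> : (fun h : R => h^-1 *: ((g \o c) (h + t) - (g \o c) t)) =
   (fun h => \sum_i (h^-1 *: (c (h + t) - c t)) i 0 * partial i g (xi h i)).
  apply/funext => h /=; have [_ _ ->] := xiP h.
  rewrite scaler_sumr; apply: eq_bigr => i _.
  by rewrite !mxE -mulrA.
apply: cvg_big => [|i _]; first exact: add_continuous.
apply: cvgM.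
  by move/is_derive1P: cdc => /cvg_cvP; exact.
have [_ [cp _]] := dg i.
apply: (cvg_comp (xi ^~ i) (partial i g) _ (cp (c t))).
apply/cvgrPdist_le => /= e e0.
move/cvgrPdist_le: cc => /(_ e e0); apply: filterS => h.
by rewrite !(distrC (c t)); apply: le_trans; have [_ + _] := xiP h; exact.
Qed.

(** The second difference of g along the i-th and j-th axes is a difference in
    direction i of a difference in direction j: two applications of the mean
    value theorem. *)
Lemma second_difference g (i j : 'I_n) x (h : R) : Ck 2 g -> 0 < h ->
  exists2 xi, `|xi - x| <= h + h &
    g (x + h *: unit_vec i + h *: unit_vec j) - g (x + h *: unit_vec j) -
    (g (x + h *: unit_vec i) - g x) =
    h ^+ 2 * partial j (partial i g) xi.
Proof.
move=> [_ dg] h0.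
have [di [_ ddi]] := dg i.
have [a /andP[]] := @MVT_between R
  (fun s => g (x + h *: unit_vec j + s *: unit_vec i) - g (x + s *: unit_vec i)) _
  0 h (fun t => is_deriveB (is_derive_line (x + h *: unit_vec j) t di)
                           (is_derive_line x t di)).
rewrite (min_l (ltW h0)) (max_r (ltW h0)) => a0 ah; rewrite subr0 !scale0r !addr0 => E1.
have [b /andP[]] := @MVT_between R
  (fun s => partial i g (x + a *: unit_vec i + s *: unit_vec j)) _ 0 h
  (fun t => is_derive_line (x + a *: unit_vec i) t (ddi j).1).
rewrite (min_l (ltW h0)) (max_r (ltW h0)) => b0 bh; rewrite subr0 !scale0r !addr0 => E2.
exists (x + a *: unit_vec i + b *: unit_vec j).
  rewrite -(addrA x) [X in `|X|]addrC addKr.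
  have nu (k : 'I_n) : `|unit_vec k| <= 1 :> R.
    apply/normcv_le => // l; rewrite mxE.
    by case: (_ && _); rewrite ?normr0 ?normr1.
  apply: (le_trans (ler_normD _ _)); rewrite !normrZ !ger0_norm // lerD //.
    by apply: le_trans ah; rewrite ler_piMr.
  by apply: le_trans bh; rewrite ler_piMr.
move: E1; rewrite (addrAC x _ (a *: _)) E2 (addrAC x _ (h *: unit_vec i)) => E1.
rewrite [RHS]mulrC expr2 mulrA -E1; ring.
Qed.

(** The second difference is symmetric in i and j, so by [second_difference] the
    two mixed derivatives agree at points arbitrarily close to x; they are
    continuous. *)
Lemma partialC g (i j : 'I_n) x :
  Ck 2 g -> partial i (partial j g) x = partial j (partial i g) x.
Proof.
move=> g2; apply/eqP; rewrite eq_sym -subr_eq0 -normr_le0.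
apply/ler_addgt0Pl => e e0; rewrite addr0.
have cont (k l : 'I_n) : {for x, continuous (partial k (partial l g))}.
  by have [_ dg] := g2; have [_ [_ ddg]] := dg l; have [_ [cg _]] := ddg k; exact: cg.
have e2 : 0 < e / 2 by rewrite divr_gt0.
have near_x (k l : 'I_n) : exists2 d, 0 < d & forall y, `|y - x| < d ->
    `|partial k (partial l g) x - partial k (partial l g) y| <= e / 2.
  have /cvgrPdist_le/(_ _ e2)/nbhs_normP[d d0 dP] := cont k l.
  by exists d => // y yd; apply: dP; rewrite /= distrC.
have [d d0 dP] := near_x i j; have [d' d'0 d'P] := near_x j i.
(* The points of [second_difference] are within 2 h < min d d' of x. *)
pose h := Num.min d d' / 4.
have m0 : 0 < Num.min d d' by rewrite lt_min d0.
have h0 : 0 < h by rewrite divr_gt0.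
have hd : h + h < d.
  by apply: lt_le_trans (_ : Num.min d d' <= d); rewrite ?ge_min ?lexx// /h; lra.
have hd' : h + h < d'.
  apply: lt_le_trans (_ : Num.min d d' <= d');
    by rewrite ?ge_min ?lexx ?orbT// /h; lra.
have [y1 y1x E1] := second_difference i j x g2 h0.
have [y2 y2x E2] := second_difference j i x g2 h0.
have E : partial j (partial i g) y1 = partial i (partial j g) y2.
  apply: (mulfI (_ : h ^+ 2 != 0)); first by rewrite expf_neq0// gt_eqF.
  have swap (p q r s : R) : p - q - (r - s) = p - r - (q - s) by ring.
  apply: etrans E2; apply: (etrans (esym E1)).
  by rewrite (addrAC x (h *: unit_vec j)) swap.
have b1 := d'P y1 (le_lt_trans y1x hd').
have b2 := dP y2 (le_lt_trans y2x hd).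
move: b1 b2; rewrite E.
move: (partial j (partial i g) x) (partial i (partial j g) x) (partial i _ y2) => p q r.
rewrite (distrC q) => b1 b2; rewrite (splitr e) -(subrKA r).
exact: le_trans (ler_normD _ _) (lerD b1 b2).
Qed.

End SeveralVariables.

(** * Global Picard iteration *)

Section GlobalPicard.
Context {R : realType}.

Lemma antiderivative (g : R -> R) : continuous g ->
  exists A : R -> R, A 0 = 0 /\ forall t : R, 0 <= t -> is_derive t 1 A (g t).
Proof.
move=> cg.
(* The base point - 1 makes t = 0 an interior point of the domain of F. *)
pose F (x : R) : R := (\int[@lebesgue_measure R]_(t in [set` `[-1, x]]) (g t))%R.
exists (fun t => F t - F 0); split; first by rewrite subrr.
move=> t t0.
have t1 : -1 < t by apply: lt_le_trans t0; rewrite ltrN10.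
have ig : lebesgue_measure.-integrable `[-1, t + 1] (EFin \o g).
  apply: continuous_compact_integrable; first exact: segment_compact.
  exact: continuous_subspaceT.
have tt1 : t < t + 1 by rewrite ltrDl.
have [dF] : derivable F t 1 /\ F^`()%classic t = g t.
  exact: continuous_FTC1_closed tt1 ig t1 (cg t).
rewrite derive1E => FE; have Ft : is_derive t 1 F (g t) by exact: DeriveDef dF FE.
by have := is_deriveB Ft (is_derive_cst (F 0) t 1); rewrite subr0.
Qed.

(** The segments of centre x k and radius 2 c / 2 ^ k are nested; l is a common
    point. *)
Lemma nested_limit (x : nat -> R) (c : R) : 0 <= c ->
  (forall k, `|x k.+1 - x k| <= c / 2 ^+ k) ->
  exists l, forall k, `|x k - l| <= 2 * c / 2 ^+ k.
Proof.
move=> c0 xc.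
pose lo k := x k - 2 * c / 2 ^+ k; pose hi k := x k + 2 * c / 2 ^+ k.
have half k : c / 2 ^+ k = 2 * (c / 2 ^+ k.+1).
  by rewrite exprS invfM; field; rewrite expf_neq0.
have loS k : lo k <= lo k.+1.
  have := xc k; rewrite /lo ler_norml -!mulrA half => /andP[]; lra.
have hiS k : hi k.+1 <= hi k.
  have := xc k; rewrite /hi ler_norml -!mulrA half => /andP[]; lra.
have lohi k : lo k <= hi k.
  by rewrite /lo /hi lerD2l ge0_cp // divr_ge0 ?mulr_ge0 ?exprn_ge0.
have lo_mono : {homo lo : i j / (i <= j)%N >-> i <= j}.
  by apply: homo_leq => //; exact: le_trans.
have hi_mono : {homo hi : i j / (i <= j)%N >-> j <= i}.
  by apply: homo_leq => // a b d ba ad; exact: le_trans ba.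
have lohi2 i j : lo i <= hi j.
  apply: le_trans (lo_mono _ _ (leq_maxl i j)) _.
  exact: le_trans (lohi _) (hi_mono _ _ (leq_maxr i j)).
exists (sup (range lo)) => k.
have ub : has_ubound (range lo) by exists (hi 0%N) => _ [i _ <-].
have s1 : lo k <= sup (range lo) by apply: ub_le_sup => //; exists k.
have s2 : sup (range lo) <= hi k.
  by apply: ge_sup; [exists (lo 0%N), 0%N | move=> _ [i _ <-]].
by move: s1 s2; rewrite /lo /hi ler_norml => *; apply/andP; split; lra.
Qed.

Lemma small_geometric (a c : R) : (forall k, a <= c / 2 ^+ k) -> a <= 0.
Proof.
move=> ac; apply/ler_addgt0Pl => e e0; rewrite addr0.
have [c0|c0] := leP c 0.
  by apply: (le_trans (ac 0%N)); rewrite expr0 divr1 (le_trans c0) // ltW.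
pose k := (Num.truncn (c / e)).+1.
apply: (le_trans (ac k)).
rewrite ler_pdivrMr ?exprn_gt0 // mulrC -ler_pdivrMr //.
apply: (le_trans (ltW (truncnS_gt _))).
by rewrite -natrX ler_nat -/k ltnW // ltn_expl.
Qed.

(** Integrating a bound c exp(K t) gains a factor 1 / K: this is what makes the
    Picard step a contraction for the norm weighted by exp(- K t). *)
Lemma exponential_comparison (n : nat) (v w dv dw : R -> 'cV[R]_n) (c K : R) :
  0 <= c -> 0 < K -> continuous v -> continuous w -> v 0 = w 0 ->
  (forall t : R, 0 < t -> is_derive t 1 v (dv t)) ->
  (forall t : R, 0 < t -> is_derive t 1 w (dw t)) ->
  (forall t, 0 < t -> `|dv t - dw t| <= c * expR (K * t)) ->
  forall t, 0 <= t -> `|v t - w t| <= c / K * expR (K * t).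
Proof.
move=> c0 K0 cv cw vw0 vdv wdw dvdw t t0.
have b0 : 0 <= c / K by rewrite divr_ge0 // ltW.
apply/normcv_le => [|i]; first by rewrite mulr_ge0 // expR_ge0.
have ci (u : R -> 'cV[R]_n) : continuous u -> continuous (fun s => u s i 0).
  move=> cu s.
  exact: (cvg_comp _ _ (cu s) (@coord_continuous _ _ _ i 0 (u s))).
have cexp : continuous (fun s : R => c / K * expR (K * s)).
  move=> s; exact: (is_derive1_continuous (is_deriveZ (c / K) (is_derive_expRM K s))).
have sgn_bound (s : R) : `|s| = 1 -> s * (v t i 0 - w t i 0) <= c / K * expR (K * t).
  move=> s1.
  suff : s * (v t i 0 - w t i 0) - c / K * expR (K * t) <=
         s * (v 0 i 0 - w 0 i 0) - c / K * expR (K * 0).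
    rewrite vw0 subrr mulr0 mulr0 expR0; lra.
  apply: (@decreasing_of_derive_le0 _
    (fun r => s * (v r i 0 - w r i 0) - c / K * expR (K * r))
    (fun r => s * (dv r i 0 - dw r i 0) - c / K * (K * expR (K * r)))) => //.
  - apply: continuous_subspaceT => r.
    apply: cvgB; last exact: cexp.
    by apply: cvgM; [exact: cvg_cst | apply: cvgB; exact: ci].
  - move=> r /andP[r0 _].
    have dvi := (is_derive_mxP _ _ _).1 (vdv r r0) i 0.
    have dwi := (is_derive_mxP _ _ _).1 (wdw r r0) i 0.
    exact: (is_deriveB (is_deriveZ s (is_deriveB dvi dwi))
                       (is_deriveZ (c / K) (is_derive_expRM K r))).
  - move=> r /andP[r0 _].
    have := le_trans (normcv_coord _ i) (dvdw r r0).
    rewrite !mxE mulrA divfK ?gt_eqF // subr_le0; apply: le_trans.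
    by apply: (le_trans (ler_norm _)); rewrite normrM s1 mul1r.
have p := sgn_bound 1 (normr1 _); have m := sgn_bound (-1) (normrN1 _).
rewrite !mxE ler_norml; apply/andP; split; lra.
Qed.

(** One Picard step: v is u0 plus the integral of h from 0, extended by u0 to
    negative times so that it is Lipschitz on the whole line. *)
Lemma integral_step (n : nat) (B : R) (h : R -> 'cV[R]_n) (u0 : 'cV[R]_n) :
  0 <= B -> continuous h -> (forall t, `|h t| <= B) ->
  exists v : R -> 'cV[R]_n,
    [/\ forall t, t <= 0 -> v t = u0,
        forall s t, `|v s - v t| <= B * `|s - t| &
        forall t : R, 0 < t -> is_derive t 1 v (h t)].
Proof.
move=> B0 ch hB.
have ci i : continuous (fun s => h s i 0).
  by move=> s; exact: (cvg_comp _ _ (ch s) (@coord_continuous _ _ _ i 0 (h s))).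
have /choice[A AP] i := antiderivative (ci i).
pose pos (t : R) := Num.max 0 t.
have pos_le s t : s <= t -> 0 <= pos t - pos s <= t - s.
  rewrite /pos => st; case: (leP 0 s) => ?; case: (leP 0 t) => ?;
    by apply/andP; split; lra.
pose v t : 'cV[R]_n := u0 + \col_i A i (pos t).
have vLip s t : s <= t -> `|v t - v s| <= B * (t - s).
  move=> st; apply/normcv_le => [|i]; first by rewrite mulr_ge0 // subr_ge0.
  rewrite !mxE opprD addrACA subrr add0r.
  have /andP[p0 pst] := pos_le s t st.
  have ps0 : 0 <= pos s by rewrite /pos le_max lexx.
  have [|||r _ ->] := @MVT_segment R (A i) (fun t => h t i 0) (pos s) (pos t).
  - by rewrite -subr_ge0.
  - move=> x; rewrite in_itv/= => /andP[sx _]; apply: (AP i).2.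
    exact: le_trans ps0 (ltW sx).
  - apply: derivable_within_continuous => x; rewrite in_itv/= => /andP[sx _].
    by have [] := (AP i).2 _ (le_trans ps0 sx).
  rewrite normrM (ger0_norm p0) ler_pM //.
  exact: le_trans (normcv_coord _ _) (hB r).
exists v; split=> [t t0|s t|t t0].
- rewrite /v /pos max_l // [X in _ + X](_ : _ = 0) ?addr0 //.
  by apply/colP => i; rewrite !mxE (AP i).1.
- have [st|/ltW ts] := leP s t.
    by rewrite distrC (distrC s) (ger0_norm (_ : 0 <= t - s)) ?subr_ge0 // vLip.
  by rewrite (ger0_norm (_ : 0 <= s - t)) ?subr_ge0 // vLip.
- apply/is_derive_mxP => i j; rewrite ord1.
  have Ai : is_derive t 1 (fun s => u0 i 0 + A i s) (h t i 0).
    have := is_deriveD (is_derive_cst (u0 i 0) t 1) ((AP i).2 t (ltW t0)).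
    by rewrite add0r.
  apply: near_eq_is_derive Ai.
  near=> s; rewrite !mxE /pos max_r //.
  by apply: ltW; near: s; exact: lt_nbhsr.
Unshelve. all: by end_near. Qed.

(** Taking K = 2 L in [exponential_comparison], each iteration halves the
    weighted distance between successive iterates, which therefore converge
    pointwise.  All iterates share the Lipschitz constant B, so the limit u is
    Lipschitz too and can be fed to one more step; the result agrees with u at
    nonnegative times, hence solves the equation. *)
Lemma picard (n : nat) (G : 'cV[R]_n -> 'cV[R]_n) (L B : R) (u0 : 'cV[R]_n) :
  0 < L -> (forall x y, `|G x - G y| <= L * `|x - y|) ->
  (forall x, `|G x| <= B) ->
  exists u : R -> 'cV[R]_n, [/\ u 0 = u0, continuous u &
    forall t : R, 0 < t -> is_derive t 1 u (G (u t))].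
Proof.
move=> L0 GL GB.
have B0 : 0 <= B := le_trans (normr_ge0 _) (GB 0).
pose Lip (u : R -> 'cV[R]_n) := forall s t, `|u s - u t| <= B * `|s - t|.
have lipschitz_cont (m : nat) (w : R -> 'cV[R]_m) (M : R) : 0 <= M ->
    (forall s t, `|w s - w t| <= M * `|s - t|) -> continuous w.
  move=> M0 wM t; apply/cvgrPdist_le => /= e e0.
  have M1 : 0 < M + 1 by rewrite ltr_wpDl.
  have d0 : 0 < e / (M + 1) by rewrite divr_gt0.
  apply: filterS (nbhsx_ballx t _ d0) => s; rewrite /ball/= => ts.
  apply: (le_trans (wM _ _)); apply: (@le_trans _ _ ((M + 1) * `|t - s|)).
    by rewrite ler_wpM2r // lerDl.
  by rewrite mulrC -ler_pdivlMr // ltW.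
have Lip_cont u : Lip u -> continuous u by exact: lipschitz_cont.
have stepE u : exists v, Lip u ->
    [/\ forall t, t <= 0 -> v t = u0, Lip v &
        forall t : R, 0 < t -> is_derive t 1 v (G (u t))].
  have [lu|nlu] := pselect (Lip u); last by exists u.
  have cGu : continuous (G \o u).
    apply: (@lipschitz_cont _ _ (L * B)); first by rewrite mulr_ge0 // ltW.
    by move=> s t; rewrite /= -mulrA; apply: (le_trans (GL _ _)); rewrite ler_pM2l.
  have [v vP] := integral_step u0 B0 cGu (fun t => GB (u t)).
  by exists v.
have [step stepP] := choice stepE.
pose U k := iter k step (cst u0).
have UL k : Lip (U k).
  elim: k => [s t|k IH]; first by rewrite subrr normr0 mulr_ge0.
  by have [] := stepP _ IH.
have Uneg k t : t <= 0 -> U k t = u0.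
  by case: k => // k t0; have [+ _ _] := stepP _ (UL k); exact.
have Uder k (t : R) : 0 < t -> is_derive t 1 (U k.+1) (G (U k t)).
  by have [_ _] := stepP _ (UL k); exact.
(* With K = 2 L the contraction factor L / K is 1 / 2. *)
pose K := 2 * L; have K0 : 0 < K by rewrite mulr_gt0.
pose c := B / K; have c0 : 0 <= c by rewrite divr_ge0 // ltW.
have Ubound k t : 0 <= t -> `|U k.+1 t - U k t| <= c / 2 ^+ k * expR (K * t).
  elim: k t => [|k IH] t t0.
    rewrite expr0 divr1.
    apply: (@exponential_comparison _ (U 1%N) (U 0%N)
      (fun t => G (U 0%N t)) (cst 0)) => //.
    - exact: Lip_cont.
    - exact: Lip_cont.
    - exact: Uneg.
    - move=> s s0; rewrite subr0; apply: (le_trans (GB _)).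
      by rewrite ler_peMr // -expR0 ler_expR mulr_ge0 // ltW.
  have -> : c / 2 ^+ k.+1 = L * (c / 2 ^+ k) / K.
    by rewrite exprS /K invfM; field; rewrite expf_neq0 // gt_eqF.
  apply: (@exponential_comparison _ (U k.+2) (U k.+1)
    (fun t => G (U k.+1 t)) (fun t => G (U k t))) => //.
  - by rewrite mulr_ge0 ?(ltW L0) // divr_ge0 // exprn_ge0.
  - exact: Lip_cont.
  - exact: Lip_cont.
  - by rewrite !Uneg.
  - move=> s s0; apply: (le_trans (GL _ _)).
    by rewrite -mulrA ler_pM2l // IH // ltW.
(* Before time 0 all iterates equal u0, and any positive weight serves. *)
pose E t := if 0 <= t then expR (K * t) else 1.
have E0 t : 0 <= E t by rewrite /E; case: ifP => // _; exact: expR_ge0.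
have UboundE k t : `|U k.+1 t - U k t| <= c * E t / 2 ^+ k.
  rewrite /E; case: ifPn => [t0|]; first by rewrite mulrAC; exact: Ubound.
  rewrite -ltNge => t0; rewrite !(Uneg _ _ (ltW t0)) subrr normr0.
  by rewrite divr_ge0 ?exprn_ge0 ?mulr1.
have /choice[u uP] t : exists l : 'cV[R]_n, forall k,
    `|U k t - l| <= 2 * (c * E t) / 2 ^+ k.
  have cE : 0 <= c * E t by rewrite mulr_ge0.
  have /choice[l lP] i : exists l, forall k, `|U k t i 0 - l| <= 2 * (c * E t) / 2 ^+ k.
    apply: nested_limit => // k.
    have := le_trans (normcv_coord _ i) (UboundE k t).
    by rewrite !mxE.
  exists (\col_i l i) => k; apply/normcv_le => [|i].
    by rewrite divr_ge0 ?exprn_ge0 // mulr_ge0.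
  by rewrite !mxE.
have uL : Lip u.
  move=> s t; rewrite -subr_le0.
  apply: (@small_geometric _ (2 * (c * E s) + 2 * (c * E t))) => k.
  rewrite lerBlDr mulrDl.
  have -> : u s - u t = (u s - U k s) + (U k s - U k t) + (U k t - u t).
    by rewrite !subrKA.
  apply: (le_trans (ler_normD _ _)).
  apply: (le_trans (lerD (ler_normD _ _) (lexx _))).
  rewrite distrC.
  have := uP s k; have := uP t k; have := UL k s t; lra.
have [w0 wL wder] := stepP _ uL.
exists (step u); split; [exact: w0 | exact: Lip_cont |].
move=> t t0; suff -> : step u t = u t by exact: wder.
apply/eqP; rewrite -subr_eq0 -normr_le0.
apply: (@small_geometric _ (2 * (c * E t))) => k.
have e1 : `|step u t - U k.+1 t| <= c / 2 ^+ k * expR (K * t).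
  have -> : c / 2 ^+ k = L * (2 * c / 2 ^+ k) / K.
    by rewrite /K; field; rewrite expf_neq0 // gt_eqF.
  apply: (@exponential_comparison _ _ _ (fun t => G (u t)) (fun t => G (U k t))) => //.
  - by rewrite mulr_ge0 ?(ltW L0) // divr_ge0 ?exprn_ge0 // mulr_ge0.
  - exact: Lip_cont.
  - exact: Lip_cont.
  - by rewrite w0 ?Uneg.
  - move=> s s0; apply: (le_trans (GL _ _)).
    rewrite -mulrA ler_pM2l // distrC.
    by have := uP s k; rewrite /E (ltW s0) mulrA (mulrAC (2 * c)).
  - exact: ltW.
have e2 := uP t k.+1.
have -> : step u t - u t = (step u t - U k.+1 t) + (U k.+1 t - u t) by rewrite subrKA.
apply: (le_trans (ler_normD _ _)).
have -> : 2 * (c * E t) / 2 ^+ k = c / 2 ^+ k * expR (K * t) + 2 * (c * E t) / 2 ^+ k.+1.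
  by rewrite /E (ltW t0) exprS invfM; field; rewrite expf_neq0.
exact: lerD.
Qed.

End GlobalPicard.

(** * The Euclidean inner product *)

Section InnerProduct.
Context {R : realType} {n : nat}.
Implicit Types x y z : 'cV[R]_n.

Definition dot x y : R := (x^T *m y) 0 0.

Lemma dotE x y : dot x y = \sum_i x i 0 * y i 0.
Proof. by rewrite /dot mxE; apply: eq_bigr => i _; rewrite mxE. Qed.

Lemma dotC x y : dot x y = dot y x.
Proof. by rewrite !dotE; apply: eq_bigr => i _; rewrite mulrC. Qed.

Lemma dotDr x y z : dot x (y + z) = dot x y + dot x z.
Proof. by rewrite /dot mulmxDr mxE. Qed.

Lemma dotNr x y : dot x (- y) = - dot x y.
Proof. by rewrite /dot mulmxN mxE. Qed.

Lemma dot0r x : dot x 0 = 0.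
Proof. by rewrite /dot mulmx0 mxE. Qed.

Lemma dotZr (a : R) x y : dot x (a *: y) = a * dot x y.
Proof. by rewrite /dot -scalemxAr mxE. Qed.

Lemma dotDl x y z : dot (x + y) z = dot x z + dot y z.
Proof. by rewrite dotC dotDr !(dotC z). Qed.

Lemma dotNl x y : dot (- x) y = - dot x y.
Proof. by rewrite dotC dotNr dotC. Qed.

Lemma dotZl (a : R) x y : dot (a *: x) y = a * dot x y.
Proof. by rewrite dotC dotZr dotC. Qed.

Lemma dot_ge0 x : 0 <= dot x x.
Proof. by rewrite dotE sumr_ge0 // => i _; rewrite -expr2 sqr_ge0. Qed.

Lemma normcv_sqr_le_dot x : `|x| ^+ 2 <= dot x x.
Proof.
rewrite -(sqr_sqrtr (dot_ge0 x)) ler_sqr ?nnegrE ?sqrtr_ge0 //.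
apply/normcv_le => [|i]; first exact: sqrtr_ge0.
rewrite -sqrtr_sqr ler_wsqrtr // dotE (bigD1 i) //= -expr2 lerDl.
by rewrite sumr_ge0 // => j _; rewrite -expr2 sqr_ge0.
Qed.

Lemma dot_le_normcv_sqr x : dot x x <= n%:R * `|x| ^+ 2.
Proof.
rewrite dotE mulr_natl -[X in _ *+ X]card_ord -sumr_const; apply: ler_sum => i _.
by rewrite -expr2 -real_normK ?num_real // ler_sqr ?nnegrE // normcv_coord.
Qed.

Lemma dot_le0 x : dot x x <= 0 -> x = 0.
Proof.
move=> x0; apply/eqP; rewrite -normr_eq0 -sqrf_eq0 eq_le sqr_ge0 andbT.
exact: le_trans (normcv_sqr_le_dot x) x0.
Qed.

Lemma euclid_norm_sqr x : euclid_norm x ^+ 2 = dot x x.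
Proof.
rewrite dotE /euclid_norm sqr_sqrtr; last first.
  by apply: sumr_ge0 => i _; exact: sqr_ge0.
by apply: eq_bigr => i _; rewrite expr2.
Qed.

Lemma continuous_dot (T : topologicalType) (f g : T -> 'cV[R]_n) :
  continuous f -> continuous g -> continuous (fun t => dot (f t) (g t)).
Proof.
move=> cf cg t.
have -> : (fun t => dot (f t) (g t)) = (fun t => \sum_i f t i 0 * g t i 0).
  by apply/funext => s; exact: dotE.
apply: cvg_big => [|i _]; first exact: add_continuous.
apply: cvgM.
  exact: ((cvg_cvP _ _).1 (cf t)).
exact: ((cvg_cvP _ _).1 (cg t)).
Qed.

Lemma is_derive_dot (f g : R -> 'cV[R]_n) (t : R) (df dg : 'cV[R]_n) :
  is_derive t 1 f df -> is_derive t 1 g dg ->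
  is_derive t 1 (fun s => dot (f s) (g s)) (dot (f t) dg + dot (g t) df).
Proof.
move=> /is_derive_mxP fdf /is_derive_mxP gdg.
have -> : (fun s => dot (f s) (g s)) = \sum_i (fun s => f s i 0 * g s i 0).
  by apply/funext => s; rewrite dotE fct_sumE.
rewrite !dotE -big_split /=.
by apply: is_derive_sum => i; exact: is_deriveM.
Qed.

End InnerProduct.

(** * Zeros of strongly monotone maps *)

Section StronglyMonotone.
Context {R : realType} {n : nat}.
Variables (P : 'cV[R]_n -> 'cV[R]_n) (m : R).
Hypothesis m0 : 0 < m.
Hypothesis P_mono : forall x y,
  m * dot (x - y) (x - y) <= dot (x - y) (P x - P y).

Lemma strongly_monotone_inj x y : P x = P y -> x = y.
Proof.
move=> Pxy; apply/eqP; rewrite -subr_eq0; apply/eqP/dot_le0.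
have := P_mono x y; by rewrite Pxy subrr dot0r pmulr_rle0.
Qed.

(** Strong monotonicity against 0 bounds m |x|^2 by x . (P x - P 0); complete
    squares. *)
Lemma strongly_monotone_coercive x :
  dot (P x) (P x) <= dot (P 0) (P 0) ->
  m ^+ 2 * dot x x <= 4 * dot (P 0) (P 0).
Proof.
move=> Px.
have := P_mono x 0; rewrite subr0 dotDr dotNr.
have := dot_ge0 (m *: x - (P x - P 0)); have := dot_ge0 (P x + P 0).
rewrite !(dotDl, dotDr, dotNl, dotNr, dotZl, dotZr).
rewrite (dotC (P 0) (P x)) (dotC (P x) x) (dotC (P 0) x).
move: (dot x (P x)) (dot x (P 0)) (dot (P x) (P 0))
  (dot (P x) (P x)) (dot (P 0) (P 0)) (dot x x) Px.
move=> a b c d e f de h1 h2 h3.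
have h3' : m * (m * f) <= m * (a - b) by rewrite ler_pM2l.
rewrite expr2; lra.
Qed.

(** Let p be the value of P at a minimum of |P|^2, and q its value after the
    step - t p.  Strong monotonicity gives p . (q - p) <= - m t |p|^2 and the
    local Lipschitz bound |q - p|^2 <= C t^2 |p|^2.  Hence
    |q|^2 <= |p|^2 - (2 m - C t) t |p|^2, which for small t contradicts
    minimality unless p = 0. *)
Lemma strongly_monotone_zero :
  continuous P ->
  (forall r, exists2 L, 0 < L & forall x y, `|x| <= r -> `|y| <= r ->
     `|P y - P x| <= L * `|y - x|) ->
  exists x, P x = 0.
Proof.
move=> cP PL.
pose a := dot (P 0) (P 0); have a0 : 0 <= a := dot_ge0 _.
(* Outside this ball |P|^2 exceeds its value a at 0, by coercivity, so a
   minimum over the ball is global. *)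
pose r := 1 + 4 * a / m ^+ 2.
have b0 : 0 <= 4 * a / m ^+ 2 by rewrite divr_ge0 ?mulr_ge0 ?exprn_ge0 // ltW.
have r0 : 0 <= r by rewrite /r; lra.
have [xh xhr xhmin] : exists2 x, x \in [set x : 'cV[R]_n | `|x| <= r] &
    forall y, y \in [set x : 'cV[R]_n | `|x| <= r] ->
      dot (P x) (P x) <= dot (P y) (P y).
  apply: (@compact_EVT_min _ _ (fun x => dot (P x) (P x))).
  - by exists 0; rewrite /= normr0.
  - exact: compact_ballcv.
  - by apply: continuous_subspaceT; exact: continuous_dot.
have min_glob y : dot (P xh) (P xh) <= dot (P y) (P y).
  have [yr|yr] := leP `|y| r; first by apply: xhmin; rewrite inE.
  have xh0 : dot (P xh) (P xh) <= a by apply: xhmin; rewrite inE /= normr0.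
  apply: (le_trans xh0); rewrite leNgt; apply/negP => /ltW /strongly_monotone_coercive.
  apply/negP; rewrite -ltNge -ltr_pdivrMl ?exprn_gt0 // mulrC -/a.
  apply: (lt_le_trans _ (normcv_sqr_le_dot y)).
  apply: (@lt_le_trans _ _ (r ^+ 2)); last by rewrite ler_sqr ?nnegrE // ltW.
  by rewrite expr2 /r; nra.
exists xh; apply/dot_le0; set p := P xh.
have [L L0 PLip] := PL (`|xh| + `|p|).
pose C := n%:R * L ^+ 2; have C0 : 0 <= C by rewrite mulr_ge0 // exprn_ge0 // ltW.
(* The step keeps the iterate in the ball where L is valid, as t <= 1, and
   makes C t <= m. *)
pose t := Num.min 1 (m / (C + 1)).
have t0 : 0 < t by rewrite lt_min ltr01 divr_gt0 // ltr_wpDl.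
have t1 : t <= 1 by rewrite ge_min lexx.
have tC : t * C <= m.
  have : t * (C + 1) <= m by rewrite -ler_pdivlMr ?ltr_wpDl // ge_min lexx orbT.
  by apply: le_trans; rewrite ler_pM2l // lerDl.
pose q := P (xh - t *: p).
have qp : `|q - p| <= L * (t * `|p|).
  have -> : t * `|p| = `|(xh - t *: p) - xh|.
    by rewrite addrAC subrr add0r normrN normrZ gtr0_norm.
  apply: PLip; first by rewrite lerDl.
  rewrite (le_trans (ler_normB _ _)) // lerD2l normrZ gtr0_norm //.
  by rewrite ler_piMl.
have qp2 : dot (q - p) (q - p) <= C * t ^+ 2 * dot p p.
  apply: (le_trans (dot_le_normcv_sqr _)).
  apply: (@le_trans _ _ (n%:R * (L * (t * `|p|)) ^+ 2)).
    by rewrite ler_wpM2l // ler_sqr ?nnegrE ?mulr_ge0 // ltW.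
  have -> : n%:R * (L * (t * `|p|)) ^+ 2 = C * t ^+ 2 * `|p| ^+ 2.
    by rewrite /C; ring.
  by rewrite ler_wpM2l ?normcv_sqr_le_dot // mulr_ge0 // sqr_ge0.
have mono := P_mono (xh - t *: p) xh.
rewrite -/q -/p addrAC subrr add0r in mono.
have qmin : dot p p <= dot q q := min_glob _.
rewrite !(dotDl, dotDr, dotNl, dotNr, dotZl, dotZr) (dotC q p) in mono qp2.
move: mono qp2 qmin (dot_ge0 p).
move: (dot p p) (dot p q) (dot q q) => pp pq qq mono qp2 qmin pp0.
have h1 : pq - pp <= - (m * t * pp).
  by rewrite -(ler_pM2l t0); lra.
have h2 : C * t ^+ 2 * pp <= m * t * pp.
  by rewrite expr2 mulrA (mulrC C) ler_wpM2r // ler_wpM2r // ltW.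
have : m * t * pp <= 0 by lra.
by rewrite -mulrA pmulr_rle0 // pmulr_rle0.
Qed.

End StronglyMonotone.

(** * The pseudo-gradient and Nash equilibria *)

Section Nash.
Context {R : realType} {N : nat}.
Variables (f : 'I_N -> 'cV[R]_N -> R) (m : R).
Hypothesis f_C2 : forall i, Ck 2 (f i).
Let P := pseudo_gradient f.

Lemma pseudo_gradient_lipschitz_ball (r : R) :
  exists2 L, 0 < L & forall x y, `|x| <= r -> `|y| <= r ->
     `|P y - P x| <= L * `|y - x|.
Proof.
have /choice[L LP] i : exists L, 0 < L /\ forall x y, `|x| <= r -> `|y| <= r ->
    `|partial i (f i) y - partial i (f i) x| <= L * `|y - x|.
  have [_ df] := f_C2 i.
  by have [L L0 fL] := Ck1_lipschitz_ball r (df i).2; exists L.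
have S0 : 0 <= \sum_i L i by apply: sumr_ge0 => i _; exact/ltW/(LP i).1.
exists (1 + \sum_i L i) => [|x y xr yr]; first by rewrite ltr_wpDr.
apply/normcv_le => [|i]; first by rewrite mulr_ge0 // addr_ge0.
rewrite !mxE; apply: (le_trans ((LP i).2 x y xr yr)); rewrite ler_wpM2r //.
rewrite (bigD1 i) //= addrCA lerDl addr_ge0 // sumr_ge0 // => j _.
exact/ltW/(LP j).1.
Qed.

Lemma pseudo_gradient_continuous : continuous P.
Proof.
move=> x; apply: (@cvg_cvP _ _ _ (nbhs x) _ _ _).2 => i.
rewrite mxE; under eq_fun do rewrite mxE.
by have [_ df] := f_C2 i; have [_ [cf _]] := df i; exact: cf.
Qed.

(** The chain rule yields the matrix with entries d_j d_i f_i, while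
    [game_hessian] has d_i d_j f_i; [partialC] identifies them. *)
Lemma pseudo_gradient_derive (c : R -> 'cV[R]_N) (t : R) (dc : 'cV[R]_N) :
  is_derive t 1 c dc ->
  is_derive t 1 (P \o c) (game_hessian f (c t) *m dc).
Proof.
move=> cdc; apply/is_derive_mxP => i j; rewrite ord1.
have [_ df] := f_C2 i.
have := Ck1_chain_rule (df i).2 cdc.
have -> : (partial i (f i) \o c) = (fun s => (P \o c) s i 0).
  by apply/funext => s; rewrite /= mxE.
congr is_derive; rewrite mxE; apply: eq_bigr => k _.
by rewrite mxE mulrC partialC.
Qed.

Lemma deviateE (x : 'cV[R]_N) i (y : R) :
  deviate x i y = x + (y - x i 0) *: unit_vec i.
Proof.
apply/colP => j; rewrite !mxE eqxx andbT.
by case: eqP => [->|_]; rewrite ?mulr1 ?mulr0 ?addr0 // addrC subrK.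
Qed.

(** At an equilibrium each f_i is minimal along its own axis, so P vanishes.
    Conversely, if P vanishes at x, monotonicity between x and x + c e_i says
    that the slope of f_i at x + c e_i along e_i has the sign of c, so f_i is
    minimal at x along that axis. *)
Lemma is_nashP (x : 'cV[R]_N) :
  0 < m ->
  (forall x y, m * dot (x - y) (x - y) <= dot (x - y) (P x - P y)) ->
  is_nash f x <-> P x = 0.
Proof.
move=> m0 P_mono.
have line i (s : R) : is_derive s 1 (fun s : R => f i (x + s *: unit_vec i))
    (P (x + s *: unit_vec i) i 0).
  have [_ df] := f_C2 i; rewrite mxE; exact: is_derive_line (df i).1.
split=> [nx|Px0 i y].
  apply/colP => i; rewrite [RHS]mxE.
  have [||||_ D0] := @derive1_at_min R (fun s : R => f i (x + s *: unit_vec i)) (-1) 1 0.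
  - by rewrite (le_trans (lerN10 _)) ?ler01.
  - by move=> s _; have [] := line i s.
  - by rewrite in_itv/= ltrN10 ltr01.
  - move=> s _; rewrite scale0r addr0.
    by have := nx i (s + x i 0); rewrite deviateE addrK.
  by have [_] := line i 0; rewrite D0 scale0r addr0 => <-.
rewrite deviateE; set d := y - x i 0.
have [c cd E] := MVT_between 0 d (line i).
rewrite -subr_ge0; rewrite scale0r addr0 subr0 in E; rewrite E.
have cP : 0 <= c * P (x + c *: unit_vec i) i 0.
  have := P_mono (x + c *: unit_vec i) x.
  have -> : x + c *: unit_vec i - x = c *: unit_vec i by rewrite addrC addKr.
  rewrite Px0 subr0 [X in _ <= X]dotZl.
  have -> : dot (unit_vec i) (P (x + c *: unit_vec i)) = P (x + c *: unit_vec i) i 0.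
    rewrite dotE (bigD1 i) //= big1 => [|j ji].
      by rewrite mxE !eqxx mul1r addr0.
    by rewrite !mxE (negbTE ji) mul0r.
  by apply: le_trans; rewrite mulr_ge0 ?dot_ge0 // ltW.
move: cd; rewrite ge_min le_max => /andP[mc cM].
have [c0|c0|c0] := ltgtP c 0; last by rewrite c0 scale0r addr0 Px0 mxE mul0r.
- rewrite nmulr_rge0 // in cP; rewrite leNgt c0 /= in mc.
  by rewrite mulr_le0 // (le_trans mc) // ltW.
- rewrite pmulr_rge0 // in cP; rewrite (leNgt c) c0 /= in cM.
  by rewrite mulr_ge0 // (le_trans _ cM) // ltW.
Qed.

End Nash.

(** * Contraction, stability and completeness of the closed loop *)

Section Dynamics.
Context {R : realType} {n : nat}.
Variables (P : 'cV[R]_n -> 'cV[R]_n) (J : 'cV[R]_n -> 'M[R]_n).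
Variables (m alpha beta : R).
Hypothesis P_mono : forall x y,
  m * dot (x - y) (x - y) <= dot (x - y) (P x - P y).
Hypothesis P_cont : continuous P.
Hypothesis P_lip : forall r, exists2 L, 0 < L &
  forall x y, `|x| <= r -> `|y| <= r -> `|P y - P x| <= L * `|y - x|.
Hypothesis P_derive : forall (c : R -> 'cV[R]_n) (t : R) (dc : 'cV[R]_n),
  is_derive t 1 c dc -> is_derive t 1 (P \o c) (J (c t) *m dc).
Hypothesis alpha_gt0 : 0 < alpha.
Hypothesis beta_lt_alpha : beta < alpha.
Hypothesis alphaB_lt_m : alpha - beta < m.

Implicit Types (x z : 'cV[R]_n) (s : 'cV[R]_n * 'cV[R]_n).

Let delta := alpha - beta.
Let delta_gt0 : 0 < delta. Proof. by rewrite subr_gt0. Qed.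

(** The closed loop with an arbitrary map P and its Jacobian J in place of the
    pseudo-gradient and the game Hessian. *)
Definition velocity_loop s : 'cV[R]_n * 'cV[R]_n :=
  (s.2, - (alpha *: P s.1) - beta *: s.2 - J s.1 *m s.2).

(** The coordinate z: the shift by P removes the Jacobian from the equations, and
    the shift by - delta x makes the energy diagonal. *)
Definition shifted_velocity s : 'cV[R]_n := s.2 + P s.1 - delta *: s.1.

(** The components [xfield] and [zfield] are the closed loop in the coordinates
    (x, z). *)
Definition xfield x z : 'cV[R]_n := z - P x + delta *: x.
Definition zfield x z : 'cV[R]_n := - (alpha *: (z + delta *: x)).
Definition energy x z : R := dot z z + alpha * delta * dot x x.
Definition rate : R := Num.min alpha (m - delta).

Lemma rate_gt0 : 0 < rate.
Proof. by rewrite lt_min alpha_gt0 subr_gt0. Qed.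

Lemma energy_ge0 x z : 0 <= energy x z.
Proof. by rewrite addr_ge0 ?mulr_ge0 ?dot_ge0 // ltW. Qed.

Lemma energy_small x z (e : R) : 0 < e ->
  energy x z < Num.min 1 (alpha * delta) * e ^+ 2 -> `|x| < e /\ `|z| < e.
Proof.
move=> e0; rewrite /energy.
have c0 : 0 < alpha * delta by rewrite mulr_gt0.
have e20 : 0 < e ^+ 2 by rewrite exprn_gt0.
have hx := normcv_sqr_le_dot x; have hz := normcv_sqr_le_dot z.
have x0 := dot_ge0 x; have z0 := dot_ge0 z => En; split.
  rewrite -ltr_sqr ?nnegrE ?(ltW e0) //; apply: (le_lt_trans hx).
  rewrite -(ltr_pM2l c0); apply: (@le_lt_trans _ _ (dot z z + alpha * delta * dot x x)).
    by rewrite lerDr.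
  by apply: (lt_le_trans En); rewrite ler_pM2r // ge_min lexx orbT.
rewrite -ltr_sqr ?nnegrE ?(ltW e0) //; apply: (le_lt_trans hz).
apply: (@le_lt_trans _ _ (dot z z + alpha * delta * dot x x)).
  by rewrite lerDl mulr_ge0 // ltW.
by apply: (lt_le_trans En); rewrite -[leRHS]mul1r ler_pM2r // ge_min lexx.
Qed.

(** The weight alpha delta of the energy is chosen so that the terms in
    (z1 - z2) . (x1 - x2) cancel. *)
Lemma dissipation x1 z1 x2 z2 :
  dot (z1 - z2) (zfield x1 z1 - zfield x2 z2) +
  alpha * delta * dot (x1 - x2) (xfield x1 z1 - xfield x2 z2) <=
  - rate * energy (x1 - x2) (z1 - z2).
Proof.
have -> : zfield x1 z1 - zfield x2 z2 =
    - (alpha *: ((z1 - z2) + delta *: (x1 - x2))).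
  by apply/colP => i; rewrite !mxE; ring.
have -> : xfield x1 z1 - xfield x2 z2 =
    (z1 - z2) - (P x1 - P x2) + delta *: (x1 - x2).
  by apply/colP => i; rewrite !mxE; ring.
have := P_mono x1 x2; have := dot_ge0 (x1 - x2); have := dot_ge0 (z1 - z2).
move: (x1 - x2) (z1 - z2) (P x1 - P x2) => x z p zz0 xx0 mono.
rewrite /energy !(dotDr, dotNr, dotZr) (dotC z x).
move: (dot x x) (dot z z) (dot x z) (dot x p) zz0 xx0 mono => xx zz xz xp zz0 xx0 mono.
have c0 : 0 <= alpha * delta by rewrite mulr_ge0 // ltW.
have h1 : rate * zz <= alpha * zz by rewrite ler_wpM2r // /rate ge_min lexx.
have h2 : rate * (alpha * delta * xx) <= (m - delta) * (alpha * delta * xx).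
  by rewrite ler_wpM2r ?(mulr_ge0 c0) // /rate ge_min lexx orbT.
have h3 : alpha * delta * (m * xx) <= alpha * delta * xp by rewrite ler_wpM2l.
lra.
Qed.

Lemma is_derive_energy (x z : R -> 'cV[R]_n) (t : R) (dx dz : 'cV[R]_n) :
  is_derive t 1 x dx -> is_derive t 1 z dz ->
  is_derive t 1 (fun r => energy (x r) (z r))
    (2 * (dot (z t) dz + alpha * delta * dot (x t) dx)).
Proof.
move=> xdx zdz.
have := is_deriveD (is_derive_dot zdz zdz)
          (is_deriveZ (alpha * delta) (is_derive_dot xdx xdx)).
congr is_derive; rewrite /GRing.scale /=; ring.
Qed.

Lemma continuous_energy (T : topologicalType) (x z : T -> 'cV[R]_n) :
  continuous x -> continuous z -> continuous (fun t => energy (x t) (z t)).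
Proof.
move=> cx cz t; apply: cvgD; first exact: continuous_dot.
by apply: cvgM; [exact: cvg_cst | exact: continuous_dot].
Qed.

Lemma continuous_shifted_velocity (T : topologicalType) (s : T -> 'cV[R]_n * 'cV[R]_n) :
  continuous s ->
  continuous (fun t => (s t).1) /\ continuous (fun t => shifted_velocity (s t)).
Proof.
move=> cs.
have c1 : continuous (fun t => (s t).1).
  move=> t.
  exact: (cvg_comp _ _ (cs t) (@cvg_fst _ _ (nbhs (s t).1) (nbhs (s t).2) _)).
have c2 : continuous (fun t => (s t).2).
  move=> t.
  exact: (cvg_comp _ _ (cs t) (@cvg_snd _ _ (nbhs (s t).1) (nbhs (s t).2) _)).
have c3 : continuous (fun t => P (s t).1).
  by move=> t; apply: continuous_comp; [exact: c1 | exact: P_cont].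
split=> // t; apply: cvgB; last by apply: cvgZr; exact: c1.
by apply: cvgD; [exact: c2 | exact: c3].
Qed.

Lemma solution_shifted_velocity (s : R -> 'cV[R]_n * 'cV[R]_n) (t : R) :
  is_derive t 1 s (velocity_loop (s t)) ->
  is_derive t 1 (fun r => (s r).1) (xfield (s t).1 (shifted_velocity (s t))) /\
  is_derive t 1 (fun r => shifted_velocity (s r))
    (zfield (s t).1 (shifted_velocity (s t))).
Proof.
move=> ds; have d1 := is_derive_fst ds; have d2 := is_derive_snd ds.
split.
  rewrite (_ : xfield _ _ = (velocity_loop (s t)).1) //.
  by apply/colP => i; rewrite !mxE; ring.
have := is_deriveB (is_deriveD d2 (P_derive d1)) (is_deriveZ delta d1).
congr is_derive; rewrite /velocity_loop /=.
by apply/colP => i; rewrite !mxE /delta; ring.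
Qed.

(** The squared distance of two states, measured in the coordinates (x, z), where
    the flow contracts. *)
Definition gap s1 s2 : R :=
  energy (s1.1 - s2.1) (shifted_velocity s1 - shifted_velocity s2).

(** By [dissipation] the derivative of the gap is at most - 2 rate times the
    gap, so multiplying by exp(2 rate t) gives a nonincreasing function. *)
Lemma gap_decay (T : \bar R) (s1 s2 : R -> 'cV[R]_n * 'cV[R]_n) :
  is_solution velocity_loop T s1 -> is_solution velocity_loop T s2 ->
  forall t, 0 <= t -> (t%:E < T)%E ->
  gap (s1 t) (s2 t) * expR (2 * rate * t) <= gap (s1 0) (s2 0).
Proof.
move=> [c1 d1] [c2 d2] t t0 tT.
have sub : `[0, t] `<=` [set r : R | 0 <= r /\ (r%:E < T)%E].
  move=> r; rewrite /= in_itv/= => /andP[r0 rt]; split=> //.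
  by apply: le_lt_trans tT; rewrite lee_fin.
have [c1x c1z] := continuous_shifted_velocity (continuous_subspaceW sub c1).
have [c2x c2z] := continuous_shifted_velocity (continuous_subspaceW sub c2).
pose W r := gap (s1 r) (s2 r) * expR (2 * rate * r).
pose x r := (s1 r).1 - (s2 r).1.
pose z r := shifted_velocity (s1 r) - shifted_velocity (s2 r).
pose dx r := xfield (s1 r).1 (shifted_velocity (s1 r)) -
  xfield (s2 r).1 (shifted_velocity (s2 r)).
pose dz r := zfield (s1 r).1 (shifted_velocity (s1 r)) -
  zfield (s2 r).1 (shifted_velocity (s2 r)).
pose D r := 2 * (dot (z r) (dz r) + alpha * delta * dot (x r) (dx r)).
have -> : gap (s1 0) (s2 0) = W 0 by rewrite /W mulr0 expR0 mulr1.
apply: (@decreasing_of_derive_le0 _ W (fun r => energy (x r) (z r) *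
    (2 * rate * expR (2 * rate * r)) + expR (2 * rate * r) * D r) 0 t) => //.
- move=> r; apply: cvgM; last first.
    apply: continuous_subspaceT => {}r.
    exact: (is_derive1_continuous (is_derive_expRM (2 * rate) r)).
  apply: (@continuous_energy (subspace `[0, t])
    (fun r => (s1 r).1 - (s2 r).1)
    (fun r => shifted_velocity (s1 r) - shifted_velocity (s2 r))) => {}r;
    apply: cvgB.
  + exact: c1x.
  + exact: c2x.
  + exact: c1z.
  + exact: c2z.
- move=> r /andP[r0 rt].
  have rT : (r%:E < T)%E by apply: lt_trans tT; rewrite lte_fin.
  have [d1x d1z] := solution_shifted_velocity (d1 r r0 rT).
  have [d2x d2z] := solution_shifted_velocity (d2 r r0 rT).
  exact: (is_deriveM (is_derive_energy (is_deriveB d1x d2x) (is_deriveB d1z d2z))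
                     (is_derive_expRM (2 * rate) r)).
- move=> r _; have := dissipation (s1 r).1 (shifted_velocity (s1 r))
    (s2 r).1 (shifted_velocity (s2 r)).
  rewrite -/(x r) -/(z r) -/(dx r) -/(dz r) => diss.
  have e0 := expR_gt0 (2 * rate * r).
  rewrite mulrA (mulrC _ (expR _)) -mulrDr pmulr_rle0 // /D.
  move: diss; move: (energy _ _) (dot (z r) _ + _) => E d; lra.
Qed.

Lemma gap_eq0 s1 s2 : gap s1 s2 <= 0 -> s1 = s2.
Proof.
have c0 : 0 < alpha * delta by rewrite mulr_gt0.
move=> g0; have xx := dot_ge0 (s1.1 - s2.1).
have zz := dot_ge0 (shifted_velocity s1 - shifted_velocity s2).
have cxx : 0 <= alpha * delta * dot (s1.1 - s2.1) (s1.1 - s2.1).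
  by rewrite mulr_ge0 // ltW.
rewrite /gap /energy in g0.
have /dot_le0/eqP : dot (s1.1 - s2.1) (s1.1 - s2.1) <= 0.
  by rewrite -(pmulr_rle0 _ c0); lra.
rewrite subr_eq0 => /eqP E1.
have /dot_le0/eqP : dot (shifted_velocity s1 - shifted_velocity s2)
    (shifted_velocity s1 - shifted_velocity s2) <= 0 by lra.
rewrite subr_eq0 /shifted_velocity E1 => /eqP /addIr /addIr E2.
by case: s1 s2 E1 E2 {g0 xx zz cxx} => a b [c d] /= -> ->.
Qed.

Lemma is_solution_sub (T T' : \bar R) (s : R -> 'cV[R]_n * 'cV[R]_n) :
  (T' <= T)%E -> is_solution velocity_loop T s -> is_solution velocity_loop T' s.
Proof.
move=> TT [cs ds]; split.
  apply: continuous_subspaceW cs => r /= [r0 rT]; split=> //.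
  exact: lt_le_trans TT.
by move=> t t0 tT; apply: ds => //; exact: lt_le_trans TT.
Qed.

Lemma solution_unique (T : \bar R) (s1 s2 : R -> 'cV[R]_n * 'cV[R]_n) :
  is_solution velocity_loop T s1 -> is_solution velocity_loop T s2 ->
  s1 0 = s2 0 -> forall t, 0 <= t -> (t%:E < T)%E -> s1 t = s2 t.
Proof.
move=> sol1 sol2 s0 t t0 tT; apply: gap_eq0.
have := gap_decay sol1 sol2 t0 tT.
rewrite s0 {2}/gap /energy !subrr !dot0r mulr0 addr0.
by rewrite pmulr_lle0 // expR_gt0.
Qed.

Section Equilibrium.
Variable xs : 'cV[R]_n.
Hypothesis Pxs : P xs = 0.
Let zs := - (delta *: xs).

Lemma equilibrium_loop : velocity_loop (xs, 0) = 0.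
Proof.
by rewrite /velocity_loop /= Pxs !scaler0 mulmx0 !oppr0 !addr0.
Qed.

Lemma equilibrium_solution T : is_solution velocity_loop T (cst (xs, 0)).
Proof.
split=> [|t _ _]; first by apply: continuous_subspaceT => r; exact: cvg_cst.
by rewrite /cst equilibrium_loop; exact: is_derive_cst.
Qed.

Lemma shifted_velocity_equilibrium : shifted_velocity (xs, 0) = zs.
Proof. by rewrite /shifted_velocity /= Pxs add0r add0r. Qed.

(** The inverse of the change of coordinates (x, nu) -> (x, z) is continuous, so
    a small gap to the equilibrium means a small distance. *)
Lemma small_gap (e : R) : 0 < e ->
  exists2 eta, 0 < eta & forall s, gap s (xs, 0) < eta -> `|s - (xs, 0)| < e.
Proof.
move=> e0.
(* Phi inverts the change of coordinates. *)
pose Phi (p : 'cV[R]_n * 'cV[R]_n) := (p.1, xfield p.1 p.2).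
have Phis : Phi (xs, zs) = (xs, 0).
  by rewrite /Phi /xfield /= Pxs subr0 addNr.
have PhiK s : Phi (s.1, shifted_velocity s) = s.
  case: s => x v; rewrite /Phi /xfield /shifted_velocity /=; congr pair.
  by apply/colP => i; rewrite !mxE; ring.
have cPhi : Phi p @[p --> (xs, zs)] --> (xs, 0 : 'cV[R]_n).
  have f1 : p.1 @[p --> (xs, zs)] --> xs by exact: cvg_fst.
  have f2 : p.2 @[p --> (xs, zs)] --> zs by exact: cvg_snd.
  have f3 : P p.1 @[p --> (xs, zs)] --> P xs.
    have : {for (xs, zs), continuous (P \o fst)}.
      by apply: continuous_comp; [exact: cvg_fst | exact: P_cont].
    by [].
  have f4 : xfield p.1 p.2 @[p --> (xs, zs)] --> xfield xs zs.
    by apply: cvgD; [exact: cvgB | exact: cvgZr].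
  by rewrite -Phis; exact: cvg_pair f1 f4.
move/cvgrPdist_lt: cPhi => /(_ _ e0)/nbhs_normP[d d0 dP].
have d0' : 0 < d by [].
exists (Num.min 1 (alpha * delta) * d ^+ 2).
  by rewrite mulr_gt0 ?exprn_gt0 // lt_min ltr01 mulr_gt0.
move=> s; rewrite /gap shifted_velocity_equilibrium => /(energy_small d0')[xd zd].
rewrite distrC -[s]PhiK; apply: dP; rewrite /= distrC.
by rewrite /Num.Def.normr /= gt_max xd zd.
Qed.

Lemma gap_near (eta : R) : 0 < eta ->
  exists2 d, 0 < d & forall s, `|s - (xs, 0)| < d -> gap s (xs, 0) < eta.
Proof.
move=> eta0.
have [c1 c2] := @continuous_shifted_velocity ('cV[R]_n * 'cV[R]_n)%type id
  (fun s => cvg_id).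
have cg : continuous (fun s => gap s (xs, 0)).
  apply: continuous_energy => s; apply: cvgB; try exact: cvg_cst.
  - exact: c1.
  - exact: c2.
have : gap s (xs, 0) @[s --> (xs, 0 : 'cV[R]_n)] --> (0 : R).
  have -> : (0 : R) = gap (xs, 0) (xs, 0).
    by rewrite /gap /energy !subrr !dot0r mulr0 addr0.
  exact: cg.
move=> /cvgrPdist_lt /(_ _ eta0)/nbhs_normP[d d0 dP]; exists d => // s sd.
have := dP s; rewrite /= distrC => /(_ sd); rewrite sub0r normrN.
by apply: le_lt_trans; exact: ler_norm.
Qed.

(** The gap to the constant solution never exceeds its initial value. *)
Lemma equilibrium_stable : lyapunov_stable velocity_loop (xs, 0).
Proof.
move=> e /small_gap[eta eta0 etaP]; have [d d0 dP] := gap_near eta0.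
exists d => // T s sol s0 t t0 tT; apply: etaP.
apply: le_lt_trans (dP _ s0).
apply: le_trans (gap_decay sol (equilibrium_solution T) t0 tT).
rewrite ler_peMr ?energy_ge0 // -expR0 ler_expR.
by rewrite mulr_ge0 // mulr_ge0 // ltW // rate_gt0.
Qed.

Lemma equilibrium_attractive : globally_attractive velocity_loop (xs, 0).
Proof.
move=> s sol; apply/cvgrPdist_lt => e e0.
have [eta eta0 etaP] := small_gap e0.
set g := gap (s 0) (xs, 0); have g0 : 0 <= g := energy_ge0 _ _.
have r0 := rate_gt0.
near=> t.
have t0 : 0 <= t by [].
rewrite distrC; apply: etaP.
have := gap_decay sol (equilibrium_solution +oo%E) t0 (ltry _).
rewrite /cst -/g -ler_pdivlMr ?expR_gt0 // => /le_lt_trans; apply.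
rewrite ltr_pdivrMr ?expR_gt0 // -ltr_pdivrMl // mulrC.
(* The bound exp(2 rate t) >= 1 + 2 rate t turns exponential decay into an
   explicit threshold on t. *)
apply: (@lt_le_trans _ _ (1 + 2 * rate * t)); last exact: expR_ge1Dx.
have : g / eta / (2 * rate) <= t by near: t; apply: nbhs_pinfty_ge; exact: num_real.
rewrite ler_pdivrMr ?mulr_gt0 //; lra.
Unshelve. all: by end_near. Qed.

Lemma field_equilibrium : xfield xs zs = 0 /\ zfield xs zs = 0.
Proof.
by rewrite /xfield /zfield Pxs subr0 addNr scaler0 oppr0.
Qed.

Let field (u : 'cV[R]_(n + n)) : 'cV[R]_(n + n) :=
  col_mx (xfield (usubmx u) (dsubmx u)) (zfield (usubmx u) (dsubmx u)).

Lemma field_lipschitz_ball (r : R) :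
  exists2 L, 0 < L & forall u v, `|u| <= r -> `|v| <= r ->
    `|field u - field v| <= L * `|u - v|.
Proof.
have [L L0 LP] := P_lip r.
exists (1 + L + delta + alpha * (1 + delta)).
  have L1 : 0 < 1 + L by rewrite addr_gt0.
  have d1 : 0 < 1 + delta by rewrite addr_gt0.
  by rewrite addr_gt0 // ?mulr_gt0 // addr_gt0.
move=> u v ur vr; rewrite /field opp_col_mx add_col_mx.
have hx := normcv_usubmx (u - v); have hz := normcv_dsubmx (u - v).
rewrite !linearB /= in hx hz.
have hP := LP _ _ (le_trans (normcv_usubmx v) vr) (le_trans (normcv_usubmx u) ur).
move: hx hz hP; move: (usubmx u) (usubmx v) (dsubmx u) (dsubmx v) => x1 x2 z1 z2 hx hz hP.
have d0 := normr_ge0 (u - v).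
have hdx : delta * `|x1 - x2| <= delta * `|u - v| by rewrite ler_pM2l.
have hLx : L * `|x1 - x2| <= L * `|u - v| by rewrite ler_pM2l.
have a1 : 0 <= alpha * ((1 + delta) * `|u - v|).
  by rewrite mulr_ge0 ?(ltW alpha_gt0) // mulr_ge0 // addr_ge0 // ltW.
have a2 : 0 <= (1 + L + delta) * `|u - v|.
  by rewrite mulr_ge0 // addr_ge0 ?(ltW delta_gt0) // addr_ge0 // ltW.
apply: normcv_col_mx.
  have -> : xfield x1 z1 - xfield x2 z2 = (z1 - z2) - (P x1 - P x2) + delta *: (x1 - x2).
    by apply/colP => i; rewrite !mxE; ring.
  apply: (le_trans (ler_normD _ _)); rewrite normrZ gtr0_norm //.
  have := ler_normB (z1 - z2) (P x1 - P x2); lra.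
have -> : zfield x1 z1 - zfield x2 z2 = - (alpha *: ((z1 - z2) + delta *: (x1 - x2))).
  by apply/colP => i; rewrite !mxE; ring.
rewrite normrN normrZ gtr0_norm //.
have : alpha * `|(z1 - z2) + delta *: (x1 - x2)| <= alpha * ((1 + delta) * `|u - v|).
  rewrite ler_pM2l //; apply: (le_trans (ler_normD _ _)); rewrite normrZ gtr0_norm //.
  lra.
lra.
Qed.

(** The cube of radius r contains the sublevel set of the energy at level b, one
    unit above the initial energy.  The solution of the clamped system cannot
    reach level b, because below it the clamping is the identity and the energy
    is dissipated. *)
Lemma global_solution s0 :
  exists2 s, is_solution velocity_loop +oo%E s & s 0 = s0.
Proof.
pose phi x z := energy (x - xs) (z - zs).
pose b := phi s0.1 (shifted_velocity s0) + 1.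
have b0 : 0 < b by rewrite ltr_wpDl ?energy_ge0.
pose mu := Num.min 1 (alpha * delta).
have mu0 : 0 < mu by rewrite lt_min ltr01 mulr_gt0.
(* Chosen with b <= mu e^2, as [energy_small] requires. *)
pose e := b / mu + 1.
have bmu : 0 < b / mu by rewrite divr_gt0.
have e0 : 0 < e by rewrite addr_gt0.
have be : b <= mu * e ^+ 2.
  rewrite mulrC -ler_pdivrMr // /e sqrrD1.
  have := sqr_ge0 (b / mu); lra.
pose r := e + `|xs| + `|zs|.
have r0 : 0 <= r by rewrite !addr_ge0 // ltW.
have inside x z : phi x z < b -> `|x| <= r /\ `|z| <= r.
  move=> /lt_le_trans/(_ be)/(energy_small e0)[xe ze].
  have := ler_normD (x - xs) xs; have := ler_normD (z - zs) zs.
  rewrite !subrK /r; have := normr_ge0 xs; have := normr_ge0 zs.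
  by move=> *; split; lra.
have [L L0 LP] := field_lipschitz_ball r.
pose G u := field (clamp r u).
have GL u v : `|G u - G v| <= L * `|u - v|.
  apply: (le_trans (LP _ _ (clamp_le _ r0) (clamp_le _ r0))).
  by rewrite ler_pM2l // clamp_lipschitz.
have GB u : `|G u| <= L * r + `|field 0|.
  have := LP (clamp r u) 0 (clamp_le _ r0); rewrite normr0 => /(_ r0).
  rewrite subr0 => h; have := ler_normD (G u - field 0) (field 0); rewrite subrK.
  have : L * `|clamp r u| <= L * r by rewrite ler_pM2l // clamp_le.
  rewrite -/(G u) in h; lra.
have [u [u0 cu du]] := picard (col_mx s0.1 (shifted_velocity s0)) L0 GL GB.
pose x t := usubmx (u t); pose z t := dsubmx (u t).
have cx : continuous x.
  move=> t; apply: (@cvg_cvP _ _ _ (nbhs t) _ _ _).2 => i.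
  rewrite mxE; under eq_fun do rewrite mxE.
  exact: ((cvg_cvP _ _).1 (cu t)).
have cz : continuous z.
  move=> t; apply: (@cvg_cvP _ _ _ (nbhs t) _ _ _).2 => i.
  rewrite mxE; under eq_fun do rewrite mxE.
  exact: ((cvg_cvP _ _).1 (cu t)).
have dx (t : R) : 0 < t -> is_derive t 1 x (usubmx (G (u t))).
  move=> t0; apply/is_derive_mxP => i j; rewrite mxE.
  under eq_fun do rewrite mxE.
  exact: ((is_derive_mxP _ _ _).1 (du t t0)).
have dz (t : R) : 0 < t -> is_derive t 1 z (dsubmx (G (u t))).
  move=> t0; apply/is_derive_mxP => i j; rewrite mxE.
  under eq_fun do rewrite mxE.
  exact: ((is_derive_mxP _ _ _).1 (du t t0)).
have Gin t : phi (x t) (z t) < b ->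
    G (u t) = col_mx (xfield (x t) (z t)) (zfield (x t) (z t)).
  move=> /inside[xr zr]; rewrite /G clamp_id // -(vsubmxK (u t)).
  exact: normcv_col_mx.
have stay t : 0 <= t -> phi (x t) (z t) < b.
  apply: (@derive_barrier _ (fun t => phi (x t) (z t))
    (fun t => 2 * (dot (z t - zs) (dsubmx (G (u t)) - 0) +
                  alpha * delta * dot (x t - xs) (usubmx (G (u t)) - 0)))).
  - apply: continuous_energy => {}t; apply: cvgB; try exact: cvg_cst.
    + exact: cx.
    + exact: cz.
  - by rewrite /x /z u0 col_mxKu col_mxKd /b ltrDl.
  - move=> {}t t0; apply: is_derive_energy.
    + exact: (is_deriveB (dx t t0) (is_derive_cst xs t 1)).
    + exact: (is_deriveB (dz t t0) (is_derive_cst zs t 1)).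
  - move=> {}t t0 /Gin ->; rewrite col_mxKu col_mxKd.
    have := dissipation (x t) (z t) xs zs.
    have [-> ->] := field_equilibrium.
    have : 0 <= rate * energy (x t - xs) (z t - zs).
      by rewrite mulr_ge0 ?energy_ge0 // ltW // rate_gt0.
    lra.
exists (fun t => (x t, xfield (x t) (z t))).
  split=> [|t t0 _].
    have cP : continuous (fun t => P (x t)).
      by move=> t; apply: continuous_comp; [exact: cx | exact: P_cont].
    have cv : continuous (fun t => xfield (x t) (z t)).
      move=> t; apply: cvgD; last by apply: cvgZr; exact: cx.
      by apply: cvgB; [exact: cz | exact: cP].
    by apply: continuous_subspaceT => t; exact: (cvg_pair (cx t) (cv t)).
  have GE := Gin t (stay t (ltW t0)).
  have dxt := dx t t0; have dzt := dz t t0; rewrite GE ?col_mxKu ?col_mxKd in dxt dzt.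
  apply: is_derive_pair => //.
  have := is_deriveD (is_deriveB dzt (P_derive dxt)) (is_deriveZ delta dxt).
  congr is_derive.
  rewrite /velocity_loop /=; move: (J (x t) *m _) => Jv.
  by apply/colP => i; rewrite !mxE /delta; ring.
rewrite /x /z u0 col_mxKu col_mxKd; case: (s0) => y v.
rewrite /xfield /shifted_velocity /=; congr pair.
by apply/colP => i; rewrite !mxE; ring.
Qed.

(** A local solution agrees, by uniqueness, with the global solution that has the
    same initial state. *)
Lemma velocity_loop_complete : forward_complete velocity_loop.
Proof.
split=> [|T s sol]; first exact: global_solution.
have [s' sol' s'0] := global_solution (s 0).
exists s' => // t t0 tT.
apply: solution_unique t0 tT => //; apply: is_solution_sub sol'; exact: leey.
Qed.

Lemma velocity_loop_gas :
  globally_asymptotically_stable velocity_loop (xs, 0).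
Proof.
split; [exact: equilibrium_loop | exact: equilibrium_stable |
        exact: velocity_loop_complete |
        exact: equilibrium_attractive].
Qed.

End Equilibrium.
End Dynamics.

(** * Global asymptotic stability of the Nash equilibrium *)

Theorem theorem3 (R : realType) (N : nat) (f : 'I_N -> 'cV[R]_N -> R)
  (f_C2 : forall i : 'I_N, Ck 2 (f i))
  (P_strongly_monotone : exists2 m : R, 0 < m &
    forall x z : 'cV[R]_N,
      ((x - z)^T *m (pseudo_gradient f x - pseudo_gradient f z)) 0 0
        >= m * euclid_norm (x - z) ^+ 2) :
  exists xstar : 'cV[R]_N,
    unique (is_nash f) xstar /\
    exists2 alpha_star : R, 0 < alpha_star &
      forall alpha : R, 0 < alpha -> alpha < alpha_star ->
        exists2 beta_star : R, 0 < beta_star &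
          forall beta : R, 0 < beta -> beta < beta_star ->
            globally_asymptotically_stable (closed_loop f alpha beta) (xstar, 0).
Proof.
have [m m0 mono] := P_strongly_monotone.
have P_mono x y : m * dot (x - y) (x - y) <=
    dot (x - y) (pseudo_gradient f x - pseudo_gradient f y).
  by rewrite -euclid_norm_sqr; exact: mono.
have P_cont := pseudo_gradient_continuous f_C2.
have P_lip := pseudo_gradient_lipschitz_ball f_C2.
have [xs Pxs] := strongly_monotone_zero m0 P_mono P_cont P_lip.
have nash_zero x := is_nashP f_C2 x m0 P_mono.
exists xs; split.
  split=> [|y /nash_zero Py]; first exact/nash_zero.
  by apply: (strongly_monotone_inj m0 P_mono); rewrite Pxs Py.
(* With alpha* = m and beta*(alpha) = alpha one has 0 < alpha - beta < m. *)
exists m => // alpha alpha0 alpha_m; exists alpha => // beta beta0 beta_alpha.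
apply: (@velocity_loop_gas _ _ _ (game_hessian f) m) => //.
- exact: pseudo_gradient_derive.
- by rewrite ltrBlDr (lt_trans alpha_m) // ltrDl.
Qed.
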